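(* Let $Q$ be a finite quiver. Given a strongly connected component $H \in Q^*$, let $b = \max\{\rho(K) \mid K \in Q^*,\ K \le H\}$ and let $\ell$ be maximal such that there is a chain $K_0 < K_1 < \dots < K_\ell \le H$ in $Q^*$ with $\rho(K_i) = b$ for $0 \le i \le \ell$. Then $\operatorname{cx}_Q(H) = [b^n n^\ell]$.
   Context: A quiver is a directed graph (loops and multiple arrows allowed). A quiver is strongly connected if for each ordered pair of vertices there is a path (possibly of length $0$) from the first to the second. A strongly connected component of a quiver is a maximal strongly connected subquiver. $Q^*$ denotes the poset of strongly connected components of $Q$, with $H \le K$ if there is a path in $Q$ beginning at a vertex of $K$ and ending at a vertex of $H$. For a strongly connected component $H$, $\rho(H)$ denotes the spectral radius of an adjacency matrix of $H$ (whose entries count the arrows from one vertex to another). For a sequence $f:\mathbb{N}\to\mathbb{R}_{\ge 0}$, its complexity class $[f(n)]$ is the set of all $g:\mathbb{N}\to\mathbb{R}_{\ge 0}$ for which there are real $c_1,c_2>0$ with $c_1 g(n)\le f(n)\le c_2 g(n)$ for all but finitely many $n$. The complexity of $H$ in $Q$ is $\operatorname{cx}_Q(H)=[f(n)]$, where $f(n)$ is the number of paths of length $n$ in $Q$ beginning at a vertex in $H$. *)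

(* Defs.v *)
From HB Require Import structures.
From mathcomp Require Import all_boot all_order all_algebra.
From mathcomp Require Import complex.
From mathcomp Require Import all_classical all_reals.

Set Implicit Arguments.
Unset Strict Implicit.
Unset Printing Implicit Defensive.

Import Order.TTheory GRing.Theory Num.Theory.

Local Open Scope ring_scope.
Local Open Scope classical_set_scope.

Record finQuiver : Type := FinQuiver {
  vertex : finType;
  arrow : finType;
  src : arrow -> vertex;
  tgt : arrow -> vertex
}.

Section Paths.
Variable Q : finQuiver.
Implicit Types (x y z : vertex Q) (a : arrow Q) (p : seq (arrow Q)).
Implicit Types (A : {set arrow Q}).

(* A path is a starting vertex together with a composable sequence of arrows,
   so that every vertex carries exactly one path of length 0. *)
Fixpoint is_path x p : bool :=
  if p is a :: p' then (src a == x) && is_path (tgt a) p' else true.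

Definition path_end x p : vertex Q := last x [seq tgt a | a <- p].

Definition adjacent A : rel (vertex Q) :=
  [rel x y | [exists a in A, (src a == x) && (tgt a == y)]].

Definition reachable A : rel (vertex Q) := connect (adjacent A).

Lemma reachableP A x y :
  reflect (exists p, [/\ is_path x p, all (mem A) p & path_end x p = y])
          (reachable A x y).
Proof.
apply: (iffP connectP) => [[s]|[p]].
  elim: s x => [|w s IHs] x /=; first by move=> _ ->; exists [::].
  move=> /andP[/exists_inP[a aA /andP[/eqP ax /eqP aw]] pws] yE.
  have [p [wp pA pe]] := IHs w pws yE.
  exists (a :: p); split=> /=; first by rewrite ax eqxx aw.
  - by rewrite aA.
  - by rewrite /path_end /= aw.
move=> [xp pA pe]; exists [seq tgt a | a <- p]; last by rewrite -pe.
elim: p x xp pA {pe} => //= a p IHp x /andP[/eqP ax ap] /andP[aA pA].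
apply/andP; split; last exact: IHp.
by apply/exists_inP; exists a; rewrite ?ax ?eqxx.
Qed.

Definition is_subquiver (S : {set vertex Q} * {set arrow Q}) : bool :=
  [forall a in S.2, (src a \in S.1) && (tgt a \in S.1)].

Record subquiver : Type := Subquiver {
  subquiver_val : {set vertex Q} * {set arrow Q};
  _ : is_subquiver subquiver_val
}.

HB.instance Definition _ := [isSub for subquiver_val].
HB.instance Definition _ := [Finite of subquiver by <:].

Definition verts (S : subquiver) : {set vertex Q} := (subquiver_val S).1.
Definition arrs (S : subquiver) : {set arrow Q} := (subquiver_val S).2.

Definition subquiver_sub (S T : subquiver) : bool :=
  (verts S \subset verts T) && (arrs S \subset arrs T).

(* The empty quiver is not regarded as strongly connected. *)
Definition strongly_connected (S : subquiver) : bool :=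
  (verts S != finset.set0) &&
  [forall x in verts S, forall y in verts S, reachable (arrs S) x y].

Definition is_component (S : subquiver) : bool :=
  strongly_connected S &&
  [forall T : subquiver,
    strongly_connected T ==> subquiver_sub S T ==> (T == S)].

Record component : Type := Component {
  component_val :> subquiver;
  _ : is_component component_val
}.

HB.instance Definition _ := [isSub for component_val].
HB.instance Definition _ := [Finite of component by <:].

Implicit Types (H K L : component).

Definition component_le H K : bool :=
  [exists x in verts K, exists y in verts H, reachable [set: arrow Q] x y].

Lemma component_leP H K :
  reflect (exists x y, [/\ x \in verts K, y \in verts H &
                           reachable [set: arrow Q] x y])
          (component_le H K).
Proof.
apply: (iffP exists_inP) => [[x xK /exists_inP[y yH xy]]|[x [y [xK yH xy]]]].
  by exists x, y.
by exists x => //; apply/exists_inP; exists y.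
Qed.

Lemma reachable_sub A x y : reachable A x y -> reachable [set: arrow Q] x y.
Proof.
move=> /reachableP[p [xp _ pe]]; apply/reachableP; exists p; split=> //.
by apply/allP => a _; rewrite inE.
Qed.

Lemma component_neq0 H : exists x, x \in verts H.
Proof. by case: H => S /= /andP[/andP[/set0Pn]]. Qed.

Lemma component_reachable H x y : x \in verts H -> y \in verts H ->
  reachable [set: arrow Q] x y.
Proof.
case: H => S /= /andP[/andP[_ /forall_inP sc] _] xS yS.
exact/(@reachable_sub (arrs S))/(forall_inP (sc x xS)).
Qed.

Let cls x : {set vertex Q} := [set y |
  reachable [set: arrow Q] x y && reachable [set: arrow Q] y x]%SET.
Let full x := (cls x, [set a | (src a \in cls x) && (tgt a \in cls x)]%SET).

Let full_subquiver x : is_subquiver (full x).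
Proof. by apply/forall_inP => a; rewrite inE. Qed.

Let full_connected x : strongly_connected (Subquiver (full_subquiver x)).
Proof.
apply/andP; split; first by apply/set0Pn; exists x; rewrite inE /reachable connect0.
apply/forall_inP => y yx; apply/forall_inP => z; rewrite /verts /arrs /= in yx *.
rewrite inE => /andP[xz zx].
have yz : reachable [set: arrow Q] y z.
  by move: yx; rewrite inE => /andP[_ yx]; apply: connect_trans xz.
have /connectP[s] := yz; elim: s y yx {yz} => [|w s IHs] y yx /=.
  by move=> _ ->; apply: connect0.
move=> /andP[yw ws] zE.
have wx : w \in cls x.
  move: yx; rewrite !inE => /andP[xy _]; apply/andP; split.
    exact: connect_trans xy (connect1 yw).
  by apply: connect_trans zx; apply/connectP; exists s.
apply: connect_trans (IHs w wx ws zE); apply: connect1.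
have /exists_inP[a _ /andP[/eqP ay /eqP aw]] := yw.
apply/exists_inP; exists a; last by rewrite ay aw !eqxx.
by rewrite inE ay aw yx wx.
Qed.

Lemma component_full H x : x \in verts H ->
  component_val H = Subquiver (full_subquiver x).
Proof.
move=> xH; have rH := @component_reachable H; move: xH rH.
case: H => S /= /andP[_ /forallP max] xS rS.
have := max (Subquiver (full_subquiver x)).
rewrite full_connected /= => /implyP H; apply/esym/eqP/H.
have sub y : y \in verts S -> y \in cls x by move=> yS; rewrite inE !rS.
apply/andP; split; apply/fintype.subsetP => // a aS.
have /forall_inP/(_ a aS)/andP[sa ta] := valP S.
by rewrite inE !sub.
Qed.

Fact component_le_refl : reflexive component_le.
Proof.
move=> H; have [x xH] := component_neq0 H.
by apply/component_leP; exists x, x; split=> //; apply: connect0.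
Qed.

Fact component_le_anti : antisymmetric component_le.
Proof.
move=> H K /andP[/component_leP[x [y [xK yH xy]]]].
move=> /component_leP[z [t [zH tK zt]]].
have yx : reachable [set: arrow Q] y x.
  apply: connect_trans (component_reachable yH zH) _.
  exact: connect_trans zt (component_reachable tK xK).
apply: val_inj; rewrite /= (component_full yH) (component_full xK).
suff E : cls y = cls x by apply: val_inj; rewrite /= /full E.
apply/setP => w; rewrite !inE; apply/andP/andP => -[h1 h2]; split.
- exact: connect_trans h1.
- exact: connect_trans yx.
- exact: connect_trans h1.
- exact: connect_trans xy.
Qed.

Fact component_le_trans : transitive component_le.
Proof.
move=> K H L /component_leP[x [y [xK yH xy]]] /component_leP[z [t [zL tK zt]]].
apply/component_leP; exists z, y; split=> //.
by apply: connect_trans zt (connect_trans (component_reachable tK xK) xy).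
Qed.

Fact component_display : Order.disp_t. Proof. exact: Order.Disp tt tt. Qed.

(* H <= K when there is a path from a vertex of K to a vertex of H. *)
HB.instance Definition _ := Order.Le_isPOrder.Build component_display component
  component_le_refl component_le_anti component_le_trans.

Definition num_paths H (n : nat) : nat :=
  #|[set xp : vertex Q * n.-tuple (arrow Q) |
      (xp.1 \in verts H) && is_path xp.1 xp.2]%SET|.

End Paths.

Section Complexity.
Variable R : realType.

Definition spectral_radius n (M : 'M[R[i]]_n) : R :=
  sup [set complex.Re `|l| | l in [set l : R[i] | eigenvalue M l]].

(* The vertices of S are ordered as in the enumeration of its vertex set. *)
Definition adjacency_matrix (Q : finQuiver) (S : subquiver Q) :
    'M[R[i]]_#|verts S| :=
  \matrix_(i, j) #|[set a in arrs S |
     (src a == enum_val i) && (tgt a == enum_val j)]%SET|%:R.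

Definition rho (Q : finQuiver) (H : component Q) : R :=
  spectral_radius (adjacency_matrix H).

Definition complexity_class (f : nat -> R) : set (nat -> R) :=
  [set g | (forall n, 0 <= g n) /\
     exists c1 c2 : R, [/\ 0 < c1, 0 < c2 &
       \forall n \near \oo, c1 * g n <= f n <= c2 * g n]].

Definition cx (Q : finQuiver) (H : component Q) : set (nat -> R) :=
  complexity_class (fun n => (num_paths H n)%:R).

Definition is_maximum d (T : porderType d) (X : set T) (m : T) : Prop :=
  X m /\ ubound X m.

(* K_0 < K_1 < ... < K_l <= H with rho K_i = b; only the values K 0, ..., K l
   matter. *)
Definition rho_chain (Q : finQuiver) (H : component Q) (b : R) (l : nat)
    (K : nat -> component Q) : Prop :=
  [/\ forall i, (i < l)%N -> (K i < K i.+1)%O,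
      (K l <= H)%O &
      forall i, (i <= l)%N -> rho (K i) = b].

End Complexity.

Arguments cx R {Q} H.

(* Main.v *)
(* Let [N n x] be the number of paths of length [n] starting at [x]. By the
   Perron-Frobenius theorem, each component [K] carries a positive vector [v]
   with [A_K v = rho K v], [A_K] being the adjacency matrix of [K].

   Upper bound: rescaled by suitable constants, [v] gives a supersolution
   [C b^n s(n) v(x)] of the recurrence for [N]. Here [s] is an iterated partial
   sum of a geometric sequence [g^n], [g < 1], and one more summation, i.e. one
   more factor [n], is needed each time a component with [rho K = b] is met.

   Lower bound: from every vertex of [K] one can leave [K] towards a smaller
   component [H] in at most [D] steps. Comparing [N (D + n)] with the paths
   which stay in [K] during [D] steps plus those which leave it towards [H]
   gains a factor [n] per element of the chain. *)
Require Import Defs.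
From mathcomp Require Import all_boot all_order all_algebra.
From mathcomp Require Import complex.
From mathcomp Require Import all_classical all_reals.
From mathcomp Require Import topology normedtype derive.
From mathcomp Require Import zify ring lra.

Set Implicit Arguments.
Unset Strict Implicit.
Unset Printing Implicit Defensive.

Import Order.TTheory GRing.Theory Num.Theory numFieldNormedType.Exports.

Local Open Scope ring_scope.
Local Open Scope classical_set_scope.

(** * The Perron vector of an irreducible nonnegative matrix *)

Section Perron.
Variable R : realType.

(** Strong connectivity of the graph of positive entries, phrased by cuts, so that enlarging a
    support or following a path into [S] uses it directly. *)
Definition irreducible_mx n (M : 'M[R]_n) : Prop :=
  forall S : {set 'I_n}, S != finset.set0 -> S != finset.setT ->
  exists i j, [/\ i \in S, j \notin S & 0 < M i j].

(* Maximizes [r] over the compact set of the pairs [(x, r)], [x] in the standard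
   simplex, such that [r x <= x M]. *)
Lemma collatz_wielandt_max n (M : 'M[R]_n.+1) : (forall i j, 0 <= M i j) ->
  exists (x : 'rV[R]_n.+1) (r : R),
   [/\ forall j, 0 <= x 0 j, x != 0, 0 <= r, (forall j, r * x 0 j <= (x *m M) 0 j) &
       forall (y : 'rV[R]_n.+1) t, (forall j, 0 <= y 0 j) -> y != 0 ->
         (forall j, t * y 0 j <= (y *m M) 0 j) -> t <= r].
Proof.
(* Summing [r * x 0 j <= (x *m M) 0 j] over [j], for [x] in the simplex, gives [r <= T]; this bound
   makes [A] compact. *)
move=> M0; pose T := \sum_i \sum_j M i j.
pose X : topologicalType := ('rV[R]_n.+1 * R)%type.
pose cube : set 'rV[R]_n.+1 := [set x : 'rV[R]_n.+1 | forall j, `[0, 1]%classic (x 0 j)].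
pose g j (p : X) : R := (p.1 *m M) 0 j - p.2 * p.1 0 j.
pose A : set X := (cube `*` `[0, T]%classic) `&`
  ([set p : X | \sum_j p.1 0 j = 1] `&` \bigcap_(j in setT) [set p : X | 0 <= g j p]).
have coordc j : continuous (fun p : X => p.1 0 j).
  move=> p; apply: (@continuous_comp _ _ _ fst (fun x : 'rV[R]_n.+1 => x 0 j)).
    exact: cvg_fst.
  exact: coord_continuous.
have sndc : continuous (fun p : X => p.2) by move=> p; exact: cvg_snd.
have T0 : 0 <= T by rewrite sumr_ge0// => i _; rewrite sumr_ge0.
have cA : compact A.
  apply: compact_closedI.
    apply: compact_setX; last exact: segment_compact.
    by apply: (@rV_compact R _ (fun=> `[0, 1]%classic)) => j; exact: segment_compact.
  apply: closedI.
    apply: (@preimage_closed _ _ (fun p : X => \sum_j p.1 0 j) [set 1]);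
      last exact: closed_eq.
    by move=> p _; apply: (continuous_big add_continuous) => j _; exact: coordc.
  apply: closed_bigI => j _.
  apply: (@preimage_closed _ _ (g j) [set y | 0 <= y]); last exact: closed_ge.
  move=> p _; apply: cvgB; last by apply: cvgM; [exact: sndc|exact: coordc].
  under eq_cvg do rewrite mxE; rewrite mxE.
  apply: (cvg_big add_continuous) => i _.
  by apply: cvgMr_tmp; exact: coordc.
have normal (y : 'rV[R]_n.+1) t : (forall j, 0 <= y 0 j) -> y != 0 -> 0 <= t ->
    (forall j, t * y 0 j <= (y *m M) 0 j) -> A ((\sum_j y 0 j)^-1 *: y, t).
  move=> y0 yN0 t0 ty.
  have s0 : 0 < \sum_j y 0 j.
    rewrite lt_neqAle sumr_ge0 ?andbT//; apply: contraNN yN0 => /eqP/esym/psumr_eq0P H.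
    by apply/eqP/rowP => j; rewrite H// mxE.
  set s := \sum_j y 0 j in s0 *.
  have xs : \sum_j (s^-1 *: y) 0 j = 1.
    by under eq_bigr do rewrite mxE; rewrite -mulr_sumr mulVf// gt_eqF.
  have x0 j : 0 <= (s^-1 *: y) 0 j by rewrite mxE mulr_ge0// invr_ge0 ltW.
  have x1 j : (s^-1 *: y) 0 j <= 1.
    by rewrite -xs (bigD1 j)//= lerDl sumr_ge0.
  have tx j : t * (s^-1 *: y) 0 j <= (s^-1 *: y *m M) 0 j.
    rewrite -scalemxAl !mxE mulrCA ler_wpM2l ?invr_ge0 ?(ltW s0)//.
    by have := ty j; rewrite mxE.
  split; [split|split] => //=.
  - by move=> j /=; rewrite in_itv/= x0 x1.
  - rewrite in_itv/= t0/= -[t]mulr1 -xs mulr_sumr /T exchange_big/= ler_sum// => j _.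
    apply: le_trans (tx j) _; rewrite mxE ler_sum// => i _.
    by rewrite ler_piMl.
  - by move=> j _; rewrite /g /= subr_ge0.
have A0 : A !=set0.
  eexists; apply: (@normal (const_mx 1) 0) => //.
  - by move=> j; rewrite mxE.
  - by apply/eqP => /rowP/(_ 0); rewrite !mxE => /eqP; rewrite oner_eq0.
  - by move=> j; rewrite mul0r mxE sumr_ge0// => i _; rewrite mxE mul1r.
have [|[x r]] := compact_EVT_max A0 cA (f := snd).
  by apply: continuous_subspaceT; exact: sndc.
rewrite inE => -[[/= xc]]; rewrite in_itv/= => /andP[r0 _] [x1 xg] rmax.
exists x, r; split=> //.
- by move=> j; have := xc j; rewrite /= in_itv/= => /andP[].
- apply/eqP => x0; have /eqP : \sum_j x 0 j = 1 by exact: x1.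
  rewrite x0 big1 => [|j _]; last by rewrite mxE.
  by rewrite eq_sym oner_eq0.
- by move=> j; have := xg j I; rewrite /g/= subr_ge0.
- move=> y t y0 yN0 ty; have [t0|t0] := leP 0 t; last exact: le_trans (ltW t0) r0.
  exact: (rmax (_, t) (mem_set (normal y t y0 yN0 t0 ty))).
Qed.

(** Multiplying by [1 + M] keeps positive entries positive, and irreducibility across the cut
    between support and zeros makes a new one positive; so [Z x] shrinks strictly until it is
    empty. *)
Lemma irreducible_mulmx_gt0 n (M : 'M[R]_n.+1) : (forall i j, 0 <= M i j) ->
  irreducible_mx M -> forall x : 'rV[R]_n.+1, (forall j, 0 <= x 0 j) -> x != 0 ->
  exists k, forall j, 0 < (x *m (1 + M) ^+ k) 0 j.
Proof.
move=> M0 irrM x x0 xN0; pose Z (x : 'rV[R]_n.+1) := [set j | x 0 j == 0]%SET.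
have [m] := ubnP #|Z x|; elim: m x x0 xN0 => // m IHm x x0 xN0 mx.
have [Zx0|ZxN0] := eqVneq (Z x) finset.set0.
  exists 0%N => j; rewrite expr0 mulmx1 lt_neqAle x0 andbT eq_sym.
  by apply/negP => xj; have := finset.in_set0 j; rewrite -Zx0 inE xj.
have [||i [j []]] := irrM (~: Z x)%SET.
- apply: contra_neq xN0 => /setP Zx; apply/rowP => i; rewrite mxE; apply/eqP.
  by have := Zx i; rewrite !inE => /negbFE.
- by apply: contra_neq ZxN0 => Zx; rewrite -[Z x]finset.setCK Zx finset.setCT.
rewrite !inE negbK => xi xj Mij.
pose y := x *m (1 + M).
have yE k : y 0 k = x 0 k + \sum_i x 0 i * M i k.
  by rewrite /y mulmxDr mulmx1 mxE mxE.
have xy k : x 0 k <= y 0 k.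
  by rewrite yE lerDl sumr_ge0// => h _; rewrite mulr_ge0.
have y0 k : 0 <= y 0 k by apply: le_trans (xy k).
have yj : 0 < y 0 j.
  rewrite yE (bigD1 i)//= addrCA; apply: ltr_pwDl.
    by rewrite mulr_gt0// lt_neqAle eq_sym xi x0.
  by rewrite addr_ge0// sumr_ge0// => h _; rewrite mulr_ge0.
have [|||k ky] := IHm y.
- exact: y0.
- by apply: contraTneq yj => ->; rewrite mxE ltxx.
- rewrite -ltnS; apply: leq_trans mx; rewrite ltnS; apply/proper_card/properP; split.
    apply/fintype.subsetP => k; rewrite !inE => /eqP yk.
    by rewrite eq_le x0 -{1}yk xy.
  by exists j; rewrite inE ?xj// gt_eqF.
- by exists k.+1 => h; rewrite exprS mulmxA; exact: ky.
Qed.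

(** For a maximizing pair [x], [r] of [collatz_wielandt_max], a nonzero defect [x *m M - r *: x]
    would become positive after multiplication by a power of [1 + M], which commutes with [M], and
    [r] could be increased. *)
Lemma perron n (M : 'M[R]_n.+1) : (forall i j, 0 <= M i j) -> irreducible_mx M ->
  exists (v : 'rV[R]_n.+1) (r : R), (forall j, 0 < v 0 j) /\ v *m M = r *: v.
Proof.
move=> M0 irrM; have [x [r [x0 xN0 r0 rx rmax]]] := collatz_wielandt_max M0.
have comm k : M *m (1 + M) ^+ k = (1 + M) ^+ k *m M.
  by apply: commrX; rewrite /GRing.comm mulrDr mulrDl mulr1 mul1r.
have M1 i j : 0 <= (1 + M) i j by rewrite !mxE addr_ge0// ler0n.
have xM : x *m M = r *: x.
  apply/eqP; rewrite -subr_eq0; apply: contraT => zN0.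
  set z := x *m M - r *: x in zN0.
  have z0 j : 0 <= z 0 j by have := rx j; rewrite !mxE subr_ge0.
  have [k kz] := irreducible_mulmx_gt0 M0 irrM z0 zN0.
  pose y := x *m (1 + M) ^+ k.
  have y0 j : 0 <= y 0 j.
    rewrite /y; elim: k {kz y} j => [|k IHk] j; first by rewrite expr0 mulmx1.
    by rewrite exprSr mulmxA mxE sumr_ge0// => i _; rewrite mulr_ge0.
  have zE : z *m (1 + M) ^+ k = y *m M - r *: y.
    by rewrite /z mulmxBl -mulmxA comm mulmxA -scalemxAl.
  have yM j : r * y 0 j < (y *m M) 0 j.
    by have := kz j; rewrite zE !mxE subr_gt0.
  have yN0 : y != 0 by apply: contraTneq (yM 0) => ->; rewrite mul0mx !mxE mulr0 ltxx.
  (* The amount by which [r] could grow; [1 + y 0 j] replaces [y 0 j] as a denominator that is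
     surely positive. *)
  pose e := \big[Num.min/1]_j (((y *m M) 0 j - r * y 0 j) / (1 + y 0 j)).
  have y1 j : 0 < 1 + y 0 j by rewrite ltr_pwDl.
  have e0 : 0 < e.
    by apply: lt_bigmin => // j _; rewrite divr_gt0// subr_gt0.
  have : r + e <= r.
    apply: (rmax y) => // j; rewrite mulrDl -lerBrDl.
    have : e <= ((y *m M) 0 j - r * y 0 j) / (1 + y 0 j) by apply: bigmin_le_cond.
    rewrite ler_pdivlMr//; apply: le_trans; rewrite ler_wpM2l ?(ltW e0)//.
    by rewrite lerDr.
  by rewrite gerDl leNgt e0.
exists x, r; split=> // j.
(* Powers of [1 + M] only rescale the eigenvector [x], so the positivity they produce already holds
   for [x]. *)
have [k kx] := irreducible_mulmx_gt0 M0 irrM x0 xN0.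
have xk : x *m (1 + M) ^+ k = (1 + r) ^+ k *: x.
  elim: k {kx} => [|k IHk]; first by rewrite !expr0 mulmx1 scale1r.
  rewrite exprSr mulmxA IHk -scalemxAl mulmxDr mulmx1 xM.
  by rewrite -{1}[x]scale1r -scalerDl scalerA exprSr.
by have := kx j; rewrite xk mxE pmulr_rgt0// exprn_gt0// ltr_pwDl.
Qed.

End Perron.

(** [eigenvalue] refers to row vectors: if [a] were not an eigenvalue, [M - a] would be invertible
    and [v], which it kills, would vanish. *)
Lemma eigenvalue_cV (F : fieldType) n (M : 'M[F]_n) a (v : 'cV[F]_n) :
  v != 0 -> M *m v = a *: v -> eigenvalue M a.
Proof.
move=> vN0 Mv; rewrite /eigenvalue /eigenspace kermx_eq0.
apply: contra vN0; rewrite row_free_unit => Mu.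
by rewrite -(mulKmx Mu v) mulmxBl Mv mul_scalar_mx subrr mulmx0.
Qed.

(* A left eigenvector u for l satisfies |l| |u| <= |u| M entrywise; pairing
   with the positive right eigenvector v gives |l| <= r. *)
Lemma spectral_radius_pos_eigenvector (R : realType) n (M : 'M[R[i]]_n)
    (v : 'cV[R[i]]_n) (r : R) : (0 < n)%N ->
  (forall i j, 0 <= M i j) -> (forall i, 0 < v i 0) ->
  M *m v = (r%:C)%C *: v -> spectral_radius M = r.
Proof.
case: n M v => // n M v _ M0 v0 Mv.
have MvE i : \sum_j M i j * v j 0 = (r%:C)%C * v i 0.
  by have /matrixP/(_ i 0) := Mv; rewrite !mxE.
have r0 : 0 <= (r%:C)%C.
  rewrite -(pmulr_lge0 _ (v0 0)) -MvE sumr_ge0// => j _.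
  by rewrite mulr_ge0// ltW.
have vN0 : v != 0 by apply: contraTneq (v0 0) => ->; rewrite mxE ltxx.
have radius l : eigenvalue M l -> `|l| <= (r%:C)%C.
  move=> /eigenvalueP[u uM uN0].
  have s0 : 0 < \sum_j `|u 0 j| * v j 0.
    rewrite lt_neqAle sumr_ge0 ?andbT; last by move=> j _; rewrite mulr_ge0// ltW.
    apply: contraNN uN0 => /eqP/esym/psumr_eq0P H; apply/eqP/rowP => j; rewrite mxE.
    have /eqP := H (fun j _ => mulr_ge0 (normr_ge0 _) (ltW (v0 j))) j isT.
    by rewrite mulf_eq0 (gt_eqF (v0 j)) orbF normr_eq0 => /eqP.
  rewrite -(ler_pM2r s0) mulr_sumr.
  apply: (@le_trans _ _ (\sum_j \sum_i `|u 0 i| * M i j * v j 0)).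
    apply: ler_sum => j _; rewrite -mulr_suml mulrA ler_wpM2r ?(ltW (v0 j))//.
    have /rowP/(_ j) := uM; rewrite !mxE -normrM => <-.
    apply: le_trans (ler_norm_sum _ _ _) _; apply: ler_sum => i _.
    by rewrite normrM (ger0_norm (M0 i j)).
  rewrite exchange_big/= mulr_sumr; apply: ler_sum => i _.
  under eq_bigr do rewrite -mulrA.
  by rewrite -mulr_sumr MvE mulrCA.
have rE : r = complex.Re `|(r%:C)%C| by rewrite (ger0_norm r0).
have reig : eigenvalue M (r%:C)%C by exact: eigenvalue_cV vN0 Mv.
have rub : ubound [set complex.Re `|l| | l in [set l : R[i] | eigenvalue M l]] r.
  by move=> _ [l /radius lr <-]; move: lr; rewrite lecE => /andP[].
apply/eqP; rewrite eq_le; apply/andP; split.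
  by apply: ge_sup => //; exists r, (r%:C)%C.
by apply: ub_le_sup; [exists r|exists (r%:C)%C].
Qed.

(** * Strongly connected components *)

Lemma connect_enter (T : finType) (e : rel T) (P : pred T) x y :
  connect e x y -> ~~ P x -> P y -> exists u w, [/\ e u w, ~~ P u & P w].
Proof.
move=> /connectP[s]; elim: s x => [|z s IHs] x /=; first by move=> _ -> /negP.
move=> /andP[xz zs] yE Px Py; have [Pz|Pz] := boolP (P z); last exact: IHs Pz Py.
by exists x, z.
Qed.

Section Components.
Variable Q : finQuiver.
Implicit Types (x y z : vertex Q) (a : arrow Q) (H K : component Q).

Lemma mem_arrs K a : (a \in arrs K) = (src a \in verts K) && (tgt a \in verts K).
Proof.
have [x xK] := component_neq0 K; have E := component_full xK.
by rewrite /arrs /verts E /= inE.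
Qed.

(** A strongly connected subquiver through [x] with the most vertices and arrows in total is maximal
    for inclusion; the search starts from [x] alone. *)
Lemma component_cover x : exists K, x \in verts K.
Proof.
have sub1 : is_subquiver ([set x], finset.set0)%SET.
  by apply/forall_inP => a; rewrite inE.
pose S1 := Subquiver sub1.
pose P (S : subquiver Q) := strongly_connected S && (x \in verts S).
have PS1 : P S1.
  rewrite /P /strongly_connected /verts/= inE eqxx andbT; apply/andP; split.
    by apply/set0Pn; exists x; rewrite inE.
  apply/forall_inP => y; rewrite inE => /eqP ->; apply/forall_inP => z.
  by rewrite inE => /eqP ->; exact: connect0.
pose m (S : subquiver Q) := (#|verts S| + #|arrs S|)%N.
have [/= S /andP[scS xS] max] := @arg_maxnP _ S1 P m PS1.
have comp : is_component S.
  rewrite /is_component scS; apply/forallP => T; apply/implyP => scT.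
  apply/implyP => /andP[vST aST].
  have := max T; rewrite /P scT (fintype.subsetP vST _ xS) => /(_ isT).
  rewrite /m => le.
  have lea := subset_leq_card aST; have lev := subset_leq_card vST.
  have vE : verts S = verts T.
    apply/eqP; rewrite eqEcard vST /= -(leq_add2r #|arrs T|).
    by rewrite (leq_trans le)// leq_add2l.
  have aE : arrs S = arrs T.
    apply/eqP; rewrite eqEcard aST /= -(leq_add2l #|verts T|).
    by rewrite (leq_trans le)// vE.
  apply/eqP/val_inj => /=; move: vE aE; rewrite /verts /arrs.
  by case: (subquiver_val S) => ? ?; case: (subquiver_val T) => ? ? /= -> ->.
by exists (Component comp).
Qed.

Lemma component_eq H K x : x \in verts H -> x \in verts K -> H = K.
Proof.
by move=> xH xK; apply: val_inj; rewrite /= (component_full xH) (component_full xK).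
Qed.

Lemma arrow_reachable a : reachable [set: arrow Q] (src a) (tgt a).
Proof. by apply: connect1; apply/exists_inP; exists a; rewrite ?inE ?eqxx. Qed.

Lemma arrow_component_lt H K a : src a \in verts K -> tgt a \in verts H ->
  tgt a \notin verts K -> (H < K)%O.
Proof.
move=> aK aH aNK; rewrite lt_neqAle; apply/andP; split.
  by apply: contraNneq aNK => <-.
by apply/component_leP; exists (src a), (tgt a); split=> //; exact: arrow_reachable.
Qed.

Lemma lt_reachable H K x : (H < K)%O -> x \in verts K ->
  exists2 z, reachable [set: arrow Q] x z & z \in verts H /\ z \notin verts K.
Proof.
rewrite lt_neqAle => /andP[HNK /component_leP[y [z [yK zH yz]]]] xK.
exists z; first exact: connect_trans (component_reachable xK yK) yz.
by split=> //; apply: contra HNK => zK; rewrite (component_eq zH zK).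
Qed.

Variable R : realType.

(** The adjacency operator of [A], acting on functions of the vertices so that no enumeration of
    them is needed. *)
Definition step (A : {set arrow Q}) (f : vertex Q -> R) x : R :=
  \sum_(a in A | src a == x) f (tgt a).

(** [perron] yields row vectors, so it is applied to the transpose [M^T]; the positive column vector
    obtained identifies its eigenvalue as the spectral radius. *)
Lemma component_perron K : exists v : vertex Q -> R,
  (forall x, x \in verts K -> 0 < v x) /\
  (forall x, x \in verts K -> step (arrs K) v x = rho R K * v x).
Proof.
have [x0 x0K] := component_neq0 K.
pose M : 'M[R]_#|verts K| := \matrix_(i, j) #|[set a in arrs K |
     (src a == enum_val i) && (tgt a == enum_val j)]%SET|%:R.
have n0 : (0 < #|verts K|)%N by apply/card_gt0P; exists x0.
have adj a : a \in arrs K -> 0 < M (enum_rank_in x0K (src a)) (enum_rank_in x0K (tgt a)).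
  move=> aK; have := aK; rewrite mem_arrs => /andP[sK tK].
  rewrite mxE ltr0n; apply/card_gt0P; exists a.
  by rewrite inE aK !enum_rankK_in// !eqxx.
have M0 i j : 0 <= M^T i j by rewrite !mxE ler0n.
(* A path in [K] from outside [S] into [S] crosses by an arrow, which gives a positive entry of
   [M^T] from its target to its source. A single vertex admits no cut, hence needs no loop. *)
have irr : irreducible_mx M^T.
  move=> S /set0Pn[i iS] SNT.
  have [j jS] : exists j, j \notin S.
    apply/existsP; apply: contraR SNT; rewrite negb_exists => /forallP H.
    by apply/eqP/setP => j; rewrite inE; apply/negPn.
  pose P := [pred x | enum_rank_in x0K x \in S].
  have sc : strongly_connected K by case: (K) => ? /= /andP[].
  have /andP[_ /forall_inP/(_ _ (enum_valP j))/forall_inP/(_ _ (enum_valP i))] := sc.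
  move=> /(@connect_enter _ _ P)[| |u [w [uw]]]; rewrite /= ?enum_valK_in//.
  have /exists_inP[a aK /andP[/eqP <- /eqP <-]] := uw => uS wS.
  by exists (enum_rank_in x0K (tgt a)), (enum_rank_in x0K (src a)); rewrite mxE adj.
have [u [r [u0 uM]]] : exists (v : 'rV[R]_#|verts K|) (r : R),
    (forall j, 0 < v 0 j) /\ v *m M^T = r *: v.
  by clear adj; move: (M) n0 M0 irr; case: #|verts K| => // n M' _; exact: perron.
have Mu : M *m u^T = r *: u^T.
  by rewrite -[M]trmxK -trmx_mul uM linearZ.
have rhoE : rho R K = r.
  apply: (@spectral_radius_pos_eigenvector R _ _ (map_mx (real_complex R) u^T)) => //.
  - by move=> i j; rewrite mxE ler0n.
  - by move=> i; rewrite !mxE ltcR.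
  - rewrite -map_mxZ -Mu map_mxM; congr (_ *m _).
    by apply/matrixP => i j; rewrite !mxE rmorph_nat.
pose v x := u 0 (enum_rank_in x0K x).
exists v; split=> [x xK|x xK]; first exact: u0.
rewrite rhoE; have /matrixP/(_ (enum_rank_in x0K x) 0) := Mu.
rewrite !mxE => <-; rewrite /step.
rewrite (partition_big (fun a => enum_rank_in x0K (tgt a)) predT)//=.
apply: eq_bigr => j _; rewrite !mxE mulr_natl -sumr_const.
apply: eq_big => [a|a /andP[_ /eqP aj]]; last by rewrite /v aj.
rewrite inE enum_rankK_in// -andbA.
have [aK|//] := boolP (a \in arrs K); rewrite /=.
have tK : tgt a \in verts K by move: aK; rewrite mem_arrs => /andP[].
congr andb; apply/eqP/eqP => [<-|->]; first by rewrite enum_rankK_in.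
by rewrite enum_valK_in.
Qed.

Lemma rho_ge0 K : 0 <= rho R K.
Proof.
have [v [v0 vr]] := component_perron K; have [x xK] := component_neq0 K.
rewrite -(pmulr_lge0 _ (v0 x xK)) -vr// sumr_ge0// => a.
by rewrite mem_arrs => /andP[/andP[_ /v0/ltW]].
Qed.

End Components.

(** * Numbers of paths *)

Section Counting.
Variables (R : realType) (Q : finQuiver).
Implicit Types (x y z : vertex Q) (a : arrow Q) (H K : component Q).

Lemma ler_step (A B : {set arrow Q}) (f g : vertex Q -> R) :
  A \subset B -> (forall x, 0 <= f x) -> (forall x, f x <= g x) ->
  forall x, step A f x <= step B g x.
Proof.
move=> AB f0 fg x; apply: (@le_trans _ _ (step B f x)); last exact: ler_sum.
rewrite /step [leRHS](bigID (mem A))/=.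
under [X in X + _]eq_bigl => a do rewrite -andbA [_ && (a \in A)]andbC andbA
  [(a \in B) && _]andbC (andb_idr (fintype.subsetP AB a)).
by rewrite lerDl sumr_ge0.
Qed.

Lemma iter_step_ge0 (A : {set arrow Q}) (f : vertex Q -> R) n x :
  (forall y, 0 <= f y) -> 0 <= iter n (step A) f x.
Proof.
by move=> f0; elim: n x => //= n IHn x; rewrite sumr_ge0.
Qed.

Lemma ler_iter_step (A B : {set arrow Q}) (f g : vertex Q -> R) n x :
  A \subset B -> (forall y, 0 <= f y) -> (forall y, f y <= g y) ->
  iter n (step A) f x <= iter n (step B) g x.
Proof.
move=> AB f0 fg; elim: n x => //= n IHn x; apply: ler_step => // y.
exact: iter_step_ge0.
Qed.

Definition npaths n x : R := iter n (step finset.setT) (fun=> 1) x.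

Lemma npaths_ge0 n x : 0 <= npaths n x.
Proof. exact: iter_step_ge0. Qed.

Lemma npathsD m n x : npaths (m + n) x = iter m (step finset.setT) (npaths n) x.
Proof. by rewrite /npaths iterD. Qed.

Lemma card_is_path n x : #|[set p : n.-tuple (arrow Q) | is_path x p]%SET|%:R = npaths n x.
Proof.
elim: n x => [|n IHn] x.
  have -> : [set p : 0.-tuple (arrow Q) | is_path x p]%SET = finset.setT.
    by apply/setP => p; rewrite !inE tuple0.
  by rewrite cardsT card_tuple expn0.
rewrite /npaths iterS -/(npaths n) /step.
under [RHS]eq_bigr => a _ do rewrite -[iter _ _ _ _]/(npaths n _) -IHn.
rewrite -natr_sum; congr _%:R; rewrite -sum1dep_card.
pose h (p : arrow Q * n.-tuple (arrow Q)) := [tuple of p.1 :: p.2].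
rewrite (reindex h)/=; last first.
  exists (fun t => (thead t, [tuple of behead t])) => [[a t] _|t _].
    by congr pair; apply: val_inj.
  by rewrite [RHS]tuple_eta; apply: val_inj.
rewrite -(pair_big_dep (fun a => src a == x) (fun a (t : n.-tuple _) => is_path (tgt a) t)
  (fun _ _ => 1%N))/=.
by apply: eq_big => [a|a _]; rewrite ?inE// sum1dep_card.
Qed.

Lemma num_pathsE H n : (num_paths H n)%:R = \sum_(x in verts H) npaths n x.
Proof.
under eq_bigr => x _ do rewrite -card_is_path.
rewrite -natr_sum; congr _%:R; rewrite /num_paths -sum1dep_card.
rewrite -(pair_big_dep (fun x => x \in verts H) (fun x (t : n.-tuple _) => is_path x t)
  (fun _ _ => 1%N))/=.
by apply: eq_bigr => x _; rewrite sum1dep_card.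
Qed.

Lemma npathsS n x : npaths n.+1 x = step finset.setT (npaths n) x.
Proof. by []. Qed.

Lemma npaths_arrow n a : npaths n (tgt a) <= npaths n.+1 (src a).
Proof.
rewrite npathsS /step (bigD1 a) ?inE ?eqxx//= lerDl sumr_ge0// => b _.
exact: npaths_ge0.
Qed.

Lemma npaths_reachable x z : reachable [set: arrow Q] x z ->
  exists d, forall n, npaths n z <= npaths (d + n) x.
Proof.
move=> /connectP[s]; elim: s x => [|w s IHs] x /=; first by move=> _ ->; exists 0%N.
move=> /andP[/exists_inP[a _ /andP[/eqP <- /eqP <-]] ws] zE.
have [d dz] := IHs _ ws zE; exists d.+1 => n.
exact: le_trans (dz n) (npaths_arrow _ _).
Qed.

(* Split the paths of length [D + n] from [x] according to whether their first
   [D] arrows all lie in [K]. *)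
Lemma npaths_exit K x z : x \in verts K -> reachable [set: arrow Q] x z ->
  z \notin verts K -> exists d, forall D n, (d <= D)%N ->
  iter D (step (arrs K)) (npaths n) x + npaths (D - d + n) z <= npaths (D + n) x.
Proof.
move=> + /connectP[s]; elim: s x => [|w s IHs] x /= xK; first by move=> _ ->; rewrite xK.
move=> /andP[/exists_inP[a _ /andP[/eqP ax /eqP aw]] ws] zE zNK.
have stay D n y : iter D (step (arrs K)) (npaths n) y <= npaths (D + n) y.
  by rewrite npathsD; apply: ler_iter_step => [|u|u];
    [exact: finset.subsetT|exact: npaths_ge0|exact: lexx].
have [wK|wNK] := boolP (w \in verts K).
  have [d dz] := IHs w wK ws zE zNK; exists d.+1 => -[//|D] n; rewrite ltnS => dD.
  rewrite addSn npathsS iterS subSS /step.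
  rewrite (bigD1 a)/=; last by rewrite mem_arrs ax xK aw wK eqxx.
  rewrite [leRHS](bigD1 a)/=; last by rewrite inE ax eqxx.
  rewrite addrAC lerD// ?aw ?dz//.
  rewrite [leRHS](bigID (mem (arrs K)))/=.
  rewrite -[leLHS]addr0 lerD ?sumr_ge0// => [|b _]; last exact: npaths_ge0.
  rewrite [leRHS](eq_bigl (fun b => (b \in arrs K) && (src b == x) && (b != a))).
    exact: ler_sum.
  by move=> b; rewrite inE/=; case: (b \in arrs K); rewrite ?andbT ?andbF.
(* Here the arrow [a] leaves [K] at once, so all paths that begin with [a] are new compared with
   those that stay in [K]. *)
have wz : reachable [set: arrow Q] w z by apply/connectP; exists s.
have [d dz] := npaths_reachable wz; exists d.+1 => -[//|D] n; rewrite ltnS => dD.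
rewrite addSn npathsS iterS subSS /step.
rewrite [leRHS](bigD1 a)/=; last by rewrite inE ax eqxx.
rewrite [leLHS]addrC; apply: lerD.
  by rewrite aw (le_trans (dz _))// addnA subnKC.
rewrite [leRHS](bigID (mem (arrs K)))/=.
rewrite -[leLHS]addr0 lerD ?sumr_ge0// => [|b _]; last exact: npaths_ge0.
rewrite [leRHS](eq_bigl (fun b => (b \in arrs K) && (src b == x))).
  exact: ler_sum.
move=> b; rewrite inE/=; have [->|_] := eqVneq b a; last by rewrite andbT andbC.
by rewrite mem_arrs aw (negPf wNK) !andbF.
Qed.

End Counting.

(** * Upper bound *)

Section FiniteBounds.
Variables (R : realType) (T : finType).

Lemma fin_uniform_ubound (P : T -> R -> Prop) :
  (forall t c c', c <= c' -> P t c -> P t c') -> (forall t, exists c, P t c) ->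
  exists2 c, 0 < c & forall t, P t c.
Proof.
move=> mono /choice[f Pf]; exists (\big[Num.max/1]_t f t); last first.
  by move=> t; apply: mono (Pf t); exact: le_bigmax.
exact: lt_le_trans ltr01 (bigmax_ge_id _ _ _ _).
Qed.

Lemma fin_pos_lbound (A : pred T) (f : T -> R) :
  (forall t, A t -> 0 < f t) -> exists2 e, 0 < e & forall t, A t -> e <= f t.
Proof.
move=> f0; exists (\big[Num.min/1]_(t | A t) f t); first exact: lt_bigmin.
by move=> t At; exact: bigmin_le_cond.
Qed.

Lemma fin_ubound (f : T -> R) : exists2 c, 0 < c & forall t, f t <= c.
Proof.
apply: fin_uniform_ubound => [t c c' cc' fc|t]; first exact: le_trans cc'.
by exists (f t).
Qed.

End FiniteBounds.

Section IteratedSums.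
Variable R : realType.

(* The m-fold summation of n |-> g ^ n: for 0 < g < 1 it decays geometrically
   if m = 0 and grows like n ^ (m - 1) otherwise. *)
Fixpoint geom_sum (g : R) m n : R :=
  if m is m'.+1 then 1 + \sum_(i < n) geom_sum g m' i else g ^+ n.

Variable g : R.
Hypotheses (g0 : 0 < g) (g1 : g < 1).

Lemma geom_sum0 m : geom_sum g m 0 = 1.
Proof. by case: m => [|m] /=; rewrite ?expr0// big_ord0 addr0. Qed.

Lemma geom_sumS m n : geom_sum g m.+1 n.+1 = geom_sum g m.+1 n + geom_sum g m n.
Proof. by rewrite /= big_ord_recr/= addrA. Qed.

Lemma geom_sum_gt0 m n : 0 < geom_sum g m n.
Proof.
elim: m n => [|m IHm] n /=; first exact: exprn_gt0.
by rewrite ltr_pwDl// sumr_ge0// => i _; exact: ltW.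
Qed.

(** A loss of at most a factor [g] per step is what a component with [rho R K < b] can absorb, since
    [rho_gap] provides [rho R K < b * g]. *)
Lemma geom_sum_ge m n : g * geom_sum g m n <= geom_sum g m n.+1.
Proof.
case: m => [|m]; first by rewrite /= exprS.
have := geom_sum_gt0 m.+1 n; have := geom_sum_gt0 m n.
by rewrite geom_sumS => t0 s0; apply: ler_wpDr; [exact: ltW|rewrite ger_pMl ?ltW].
Qed.

(** The geometric series is bounded by [(1 - g)^-1], and each further summation costs one power of
    [n]. *)
Lemma geom_sum_le m : exists2 C, 0 < C & forall n, geom_sum g m.+1 n <= C * n.+1%:R ^+ m.
Proof.
elim: m => [|m [C C0 IHm]].
  have g1' : 0 < 1 - g by rewrite subr_gt0.
  exists (1 + (1 - g)^-1) => [|n]; first by rewrite addr_gt0 ?invr_gt0.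
  rewrite expr0 mulr1 /= lerD2l -div1r ler_pdivlMr// mulrC.
  have := subrX1 g n; rewrite -opprB -[g - 1]opprB mulNr => /oppr_inj <-.
  by rewrite gerBl exprn_ge0// ltW.
exists (1 + C) => [|n]; first exact: addr_gt0.
elim: n => [|n IHn]; first by rewrite geom_sum0 expr1n mulr1 lerDl ltW.
rewrite geom_sumS; apply: le_trans (lerD IHn (IHm n)) _.
apply: (@le_trans _ _ ((1 + C) * n.+2%:R * n.+1%:R ^+ m)); last first.
  rewrite exprS mulrA ler_wpM2l//; first by rewrite mulr_ge0 ?ler0n ?addr_ge0 ?ltW.
  by rewrite lerXn2r ?nnegrE ?ler0n// ler_nat.
rewrite exprS mulrA -mulrDl ler_wpM2r ?exprn_ge0 ?ler0n// -[n.+2%:R]natr1 mulrDr.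
by rewrite lerD2l mulr1 lerDr.
Qed.

End IteratedSums.

Section UpperBound.
Variables (R : realType) (Q : finQuiver).
Implicit Types (x y z : vertex Q) (a : arrow Q) (H K L : component Q).

(* The factor [v(x) b^n S(n)] is a supersolution up to a constant: [d * t n] is
   the room left for the arrows which leave [K]. *)
Lemma npaths_supersolution K (b B d : R) (t S : nat -> R) : 0 < b -> 0 < d ->
  (forall n, 0 <= t n) -> (forall n, 0 <= S n) -> S 0%N = 1 ->
  (forall n, rho R K * S n + d * t n <= b * S n.+1) ->
  (forall a n, src a \in verts K -> tgt a \notin verts K ->
     npaths R n (tgt a) <= B * b ^+ n * t n) ->
  exists C, forall x n, x \in verts K -> npaths R n x <= C * b ^+ n * S n.
Proof.
move=> b0 d0 t0 S0 S1 Sr Bt; have [v [v0 vr]] := component_perron R K.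
have [e e0 ev] := fin_pos_lbound v0; have [V V0 vV] := fin_ubound v.
(* [B'] bounds the total over the arrows leaving [K], with [Num.max 0 B] since [B] may be negative.
   [C] ensures [1 + B' / d <= C * v x]: the [1] serves length 0, and [B' / d] pays for the leaving
   arrows. *)
pose B' := #|arrow Q|%:R * Num.max 0 B.
pose C := (1 + B' / d) / e.
have BM0 : 0 <= Num.max 0 B by rewrite le_max lexx.
have B'0 : 0 <= B' by rewrite mulr_ge0.
have C0 : 0 < C by rewrite divr_gt0// ltr_pwDl// divr_ge0// ltW.
have Cv x : x \in verts K -> 1 + B' / d <= C * v x.
  move=> xK; rewrite -[leLHS](@divfK _ e) ?gt_eqF// ler_wpM2l ?(ltW C0)//.
  exact: ev.
have bn n : 0 <= b ^+ n by rewrite exprn_ge0 ?ltW.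
have key n x : x \in verts K -> npaths R n x <= C * v x * b ^+ n * S n.
  elim: n x => [|n IHn] x xK.
    rewrite S1 expr0 !mulr1; apply: le_trans (Cv x xK).
    by rewrite lerDl divr_ge0// ltW.
  rewrite npathsS /step (bigID (mem (arrs K)))/=.
  have in_ : \sum_(a | (a \in finset.setT) && (src a == x) && (a \in arrs K))
      npaths R n (tgt a) <= C * rho R K * v x * b ^+ n * S n.
    apply: (@le_trans _ _ (C * b ^+ n * S n * step (arrs K) v x)); last first.
      by rewrite vr// le_eqVlt; apply/orP; left; apply/eqP; ring.
    rewrite /step mulr_sumr.
    rewrite (eq_bigl (fun a => (a \in arrs K) && (src a == x))); last first.
      by move=> a; rewrite inE andbC.
    apply: ler_sum => a /andP[]; rewrite mem_arrs => /andP[_ tK] _.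
    by apply: le_trans (IHn _ tK) _; rewrite le_eqVlt; apply/orP; left; apply/eqP; ring.
  have out : \sum_(a | (a \in finset.setT) && (src a == x) && (a \notin arrs K))
      npaths R n (tgt a) <= B' * b ^+ n * t n.
    apply: (@le_trans _ _ (\sum_(a : arrow Q) Num.max 0 B * b ^+ n * t n)).
      rewrite [leRHS](bigID
        (fun a => (a \in finset.setT) && (src a == x) && (a \notin arrs K)))/=.
      rewrite -[leLHS]addr0; apply: lerD; last first.
        by apply: sumr_ge0 => a _; rewrite !mulr_ge0.
      apply: ler_sum => a /andP[/andP[_ /eqP ax]]; rewrite mem_arrs ax xK/= => tK.
      apply: le_trans (Bt a n _ tK) _; rewrite ?ax//.
      by rewrite !ler_wpM2r// le_max lexx orbT.
    by rewrite sumr_const -[leLHS]mulr_natl /B' !mulrA.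
  apply: le_trans (lerD in_ out) _.
  have -> : C * v x * b ^+ n.+1 * S n.+1 = C * v x * b ^+ n * (b * S n.+1).
    by rewrite exprSr; ring.
  apply: (@le_trans _ _ (C * v x * b ^+ n * (rho R K * S n + d * t n))); last first.
    by rewrite ler_wpM2l// (mulr_ge0 (mulr_ge0 (ltW C0) (ltW (v0 _ xK))) (bn n)).
  rewrite [leRHS]mulrDr; apply: lerD.
    by rewrite le_eqVlt; apply/orP; left; apply/eqP; ring.
  have -> : C * v x * b ^+ n * (d * t n) = (C * v x * d) * b ^+ n * t n by ring.
  rewrite !ler_wpM2r// -ler_pdivrMr//.
  by apply: le_trans (Cv x xK); rewrite lerDr.
exists (C * V) => x n xK; apply: le_trans (key n x xK) _.
by rewrite !ler_wpM2r// ler_wpM2l// ltW.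
Qed.

(** Finitely many components leave a gap under [b]: [b * g] is the midpoint between [b] and the
    largest [rho R K] below it, or [0] if there is none. *)
Lemma rho_gap (b : R) : 0 < b -> exists g : R,
  [/\ 0 < g, g < 1 & forall K, rho R K < b -> rho R K < b * g].
Proof.
move=> b0; pose M := \big[Num.max/0]_(K : component Q | rho R K < b) rho R K.
have Mb : M < b by exact: bigmax_lt.
have M0 : 0 <= M by exact: bigmax_ge_id.
exists ((M + b) / 2 / b); split.
- by rewrite !divr_gt0// ltr_wpDl.
- by rewrite ltr_pdivrMr// mul1r ltr_pdivrMr//; lra.
- move=> K Kb; rewrite mulrC divfK ?gt_eqF// ltr_pdivlMr//.
  have : rho R K <= M by exact: (le_bigmax_cond _ (fun K => rho R K)).
  by move: Mb Kb; lra.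
Qed.

Lemma rho_chain_le H K b k c : (H <= K)%O -> @rho_chain R Q H b k c -> rho_chain K b k c.
Proof. by move=> HK [lt le e]; split=> //; exact: le_trans HK. Qed.

Lemma rho_chain_rcons H K b k c : (H < K)%O -> rho R K = b -> @rho_chain R Q H b k c ->
  exists c', rho_chain K b k.+1 c'.
Proof.
move=> HK Kb [lt le e]; exists (fun i => if (i <= k)%N then c i else K); split.
- move=> i; rewrite ltnS => ik; rewrite ik; have [ik'|] := ltnP i k; first exact: lt.
  by move=> ki; rewrite (@anti_leq i k) ?ik// (le_lt_trans le).
- by rewrite ltnn.
- by move=> i _; case: ifP => [/e|].
Qed.

(** Induction on the number of components below [K]. Without a chain of last index [m], chains have
    at most [m] members, and [geom_sum g m] has one summation for each. *)
Lemma npaths_le (b g : R) K m : 0 < b -> 0 < g -> g < 1 ->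
  (forall L, rho R L < b -> rho R L < b * g) ->
  (forall L, (L <= K)%O -> rho R L <= b) ->
  ~ (exists c, rho_chain K b m c) ->
  exists C, forall x n, x \in verts K -> npaths R n x <= C * b ^+ n * geom_sum g m n.
Proof.
move=> b0 g0 g1 gap; have [p] := ubnP #|[pred L : component Q | (L < K)%O]|.
elim: p K m => // p IHp K m Kp Kb nochain.
have s0 k n : 0 <= geom_sum g k n by rewrite ltW// geom_sum_gt0.
have bn n : 0 <= b ^+ n by rewrite exprn_ge0 ?ltW.
have lower k : (forall L, (L < K)%O -> ~ exists c, rho_chain L b k c) ->
    exists B, forall a n, src a \in verts K -> tgt a \notin verts K ->
      npaths R n (tgt a) <= B * b ^+ n * geom_sum g k n.
  move=> nochainL.
  have [|L|B _ HB] := @fin_uniform_ubound R (component Q) (fun L C => (L < K)%O ->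
    forall x n, x \in verts L -> npaths R n x <= C * b ^+ n * geom_sum g k n).
  - move=> L c c' cc' H LK x n xL; apply: le_trans (H LK x n xL) _.
    by rewrite !ler_wpM2r.
  - have [LK|] := boolP (L < K)%O; last by exists 0.
    have [|L' L'L|C HC] := IHp L k _ _ (nochainL L LK).
    + rewrite -ltnS; apply: leq_trans Kp; rewrite ltnS.
      apply/proper_card/properP; split.
        by apply/fintype.subsetP => L'; rewrite !inE => /lt_trans; apply.
      by exists L; rewrite !inE ?ltxx.
    + exact/Kb/(le_trans L'L)/ltW.
    + by exists C.
  exists B => a n aK aNK; have [L aL] := component_cover (tgt a).
  exact: HB (arrow_component_lt aK aL aNK) _ _ aL.
(* If [rho R K < b], the components below [K] satisfy the hypothesis with the same [m], and
   [b * g - rho R K] is the room for the arrows that leave [K]. *)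
have [Keq|Klt] := eqVneq (rho R K) b; last first.
  have {}Klt : rho R K < b by rewrite lt_neqAle Klt Kb.
  have [|B HB] := lower m.
    move=> L /ltW LK [c cL]; apply: nochain; exists c; exact: rho_chain_le cL.
  apply: (@npaths_supersolution K b B (b * g - rho R K) _ _ _ _ _ _ _ _ HB) => //.
  - by rewrite subr_gt0 gap.
  - exact: geom_sum0.
  - move=> n; rewrite -mulrDl addrC subrK -mulrA ler_wpM2l ?(ltW b0)//.
    exact: geom_sum_ge.
(* If [rho R K = b], then [K] alone is a chain, so [m] is positive, and chains below [K] are shorter
   by one; the identity [geom_sumS] provides the room. *)
case: m nochain => [[]|m nochain].
  by exists (fun=> K); split.
have [|B HB] := lower m.
  by move=> L LK [c cL]; apply: nochain; exact: rho_chain_rcons LK Keq cL.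
apply: (@npaths_supersolution K b B b _ _ _ _ _ _ _ _ HB) => //.
- exact: geom_sum0.
- by move=> n; rewrite geom_sumS Keq -mulrDr.
Qed.

End UpperBound.

(** * Lower bound *)

(** A discrete derivative: gains of order [k ^ j] at each step add up to growth of order
    [k ^ j.+1]. *)
Lemma leq_expnS_increment j : exists q, forall k,
  (k.+2 ^ j.+1 <= k.+1 ^ j.+1 + q * k.+1 ^ j)%N.
Proof.
elim: j => [|j [q Hq]]; first by exists 1%N => k; rewrite !expn1 mul1n addn1.
exists (1 + 2 * q)%N => k; rewrite expnS.
apply: (leq_trans (leq_mul (leqnn k.+2) (Hq k))).
rewrite [(k.+1 ^ j.+2)%N]expnS; have := expnS k.+1 j; nia.
Qed.

Section LowerBound.
Variables (R : realType) (Q : finQuiver).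
Implicit Types (x y z : vertex Q) (a : arrow Q) (H K L : component Q).

Lemma iter_step_perron K (v f : vertex Q -> R) c n x :
  (forall y, y \in verts K -> step (arrs K) v y = rho R K * v y) ->
  (forall y, y \in verts K -> c * v y <= f y) ->
  x \in verts K -> c * rho R K ^+ n * v x <= iter n (step (arrs K)) f x.
Proof.
move=> vr vf; elim: n x => [|n IHn] x xK; first by rewrite expr0 mulr1 vf.
rewrite iterS exprSr mulrA -mulrA -vr// /step mulr_sumr; apply: ler_sum => a.
by rewrite mem_arrs => /andP[/andP[_ tK] _]; exact: IHn.
Qed.

(** Paths that stay in [K] suffice: the constant 1 dominates [v / V], which [step (arrs K)]
    multiplies by [rho R K] on [K]. *)
Lemma npaths_ge_exp K : exists2 c, 0 < c & forall x n, x \in verts K ->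
  c * rho R K ^+ n <= npaths R n x.
Proof.
have [v [v0 vr]] := component_perron R K.
have [e e0 ev] := fin_pos_lbound v0; have [V V0 vV] := fin_ubound v.
exists (e / V) => [|x n xK]; first exact: divr_gt0.
have r0 := rho_ge0 R K.
apply: (@le_trans _ _ (V^-1 * rho R K ^+ n * v x)).
  rewrite [leRHS]mulrAC [e / V]mulrC ler_wpM2r ?exprn_ge0//.
  by rewrite ler_wpM2l ?invr_ge0 ?(ltW V0)// ev.
apply: (@le_trans _ _ (iter n (step (arrs K)) (fun=> 1) x)).
  by apply: iter_step_perron => // y yK; rewrite mulrC ler_pdivrMr// mul1r.
by apply: ler_iter_step => [|y|y]; [exact: finset.subsetT|exact: ler01|exact: lexx].
Qed.

Lemma npaths_exit_uniform H K : (H < K)%O -> exists2 D, (0 < D)%N &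
  forall x, x \in verts K -> exists e z, [/\ (e <= D)%N, z \in verts H &
    forall n, iter D (step (arrs K)) (npaths R n) x + npaths R (e + n) z <=
      npaths R (D + n) x].
Proof.
move=> HK.
have /choice[d Hd] : forall x, exists d : nat, x \in verts K -> exists2 z, z \in verts H &
    forall D n, (d <= D)%N ->
    iter D (step (arrs K)) (npaths R n) x + npaths R (D - d + n) z <= npaths R (D + n) x.
  move=> x; have [xK|] := boolP (x \in verts K); last by exists 0%N.
  have [z xz [zH zNK]] := lt_reachable HK xK.
  by have [d Hd] := npaths_exit R xK xz zNK; exists d => _; exists z.
(* The successor makes [D] positive, as the later division by [D] requires; the [D - d x] steps left
   over are spent after reaching [z]. *)
exists (\max_x d x).+1 => // x xK; have [z zH Hz] := Hd x xK.
exists ((\max_x d x).+1 - d x)%N, z; split=> //; first exact: leq_subr.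
by move=> n; apply: Hz; rewrite ltnW// ltnS leq_bigmax.
Qed.

(** Induction on the number [k] of blocks of [D] steps: in each block the paths staying in [K]
    multiply the bound by [b ^+ D], and the exits towards [H] add a term of order
    [b ^+ n * k.+1%:R ^+ j]. *)
Lemma npaths_ge_step H K (b c : R) j : (H < K)%O -> rho R K = b -> 0 < b -> 0 < c ->
  (forall z n, z \in verts H -> c * b ^+ n * n.+1%:R ^+ j <= npaths R n z) ->
  exists2 c', 0 < c' & forall x n, x \in verts K ->
    c' * b ^+ n * n.+1%:R ^+ j.+1 <= npaths R n x.
Proof.
move=> HK Kb b0 c0 Hc.
have [v [v0 vr]] := component_perron R K.
have [e e0 ev] := fin_pos_lbound v0; have [V V0 vV] := fin_ubound v.
have [c1 c10 Hc1] := npaths_ge_exp K; rewrite Kb in vr Hc1.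
have [D D0 HD] := npaths_exit_uniform HK.
have [q Hq] := leq_expnS_increment j.
have bn n : 0 < b ^+ n by rewrite exprn_gt0.
(* A lower bound for all [b ^+ f] with [f <= D], whether [b] is below or above 1. *)
pose b1 := Num.min 1 b ^+ D.
have m0 : 0 < Num.min 1 b by rewrite lt_min ltr01.
have b10 : 0 < b1 by rewrite exprn_gt0.
have b1e f : (f <= D)%N -> b1 <= b ^+ f.
  move=> fD; rewrite /b1 -(subnK fD) exprD -[leRHS]mul1r.
  apply: ler_pM; rewrite ?exprn_ge0 ?(ltW m0)//.
    by rewrite exprn_ile1 ?(ltW m0)// ge_min lexx.
  by rewrite lerXn2r ?nnegrE ?(ltW m0) ?(ltW b0)// ge_min lexx orbT.
(* The first bound on [C] is for [k = 0]; the second lets the exits of one block pay for the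
   increment from [k.+1] to [k.+2]. *)
pose C := Num.min (c1 / V) (c * b1 / (V * b ^+ D * q.+1%:R)).
have VbD0 : 0 < V * b ^+ D * q.+1%:R by rewrite !mulr_gt0.
have C0 : 0 < C by rewrite lt_min !divr_gt0// mulr_gt0.
have Cc1 : C * V <= c1 by rewrite -ler_pdivlMr// ge_min lexx.
have Cq : C * (V * b ^+ D * q.+1%:R) <= c * b1.
  by rewrite -ler_pdivlMr// ge_min lexx orbT.
clearbody C b1.
have key k r x : x \in verts K ->
    C * v x * b ^+ (k * D + r) * k.+1%:R ^+ j.+1 <= npaths R (k * D + r) x.
  elim: k x => [|k IHk] x xK.
    rewrite expr1n mulr1; apply: le_trans (Hc1 _ _ xK).
    rewrite ler_wpM2r ?(ltW (bn _))//; apply: le_trans Cc1.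
    by rewrite ler_wpM2l ?(ltW C0).
  have [f [z [fD zH Hz]]] := HD x xK.
  rewrite mulSn -addnA; set n := (k * D + r)%N.
  apply: le_trans (Hz n).
  apply: (@le_trans _ _ (C * b ^+ n * k.+1%:R ^+ j.+1 * b ^+ D * v x +
    c * b1 * b ^+ n * k.+1%:R ^+ j)); last first.
    apply: lerD.
      rewrite -[in leLHS]Kb; apply: iter_step_perron => [y yK|y yK|//]; rewrite Kb ?vr//.
      by apply: le_trans (IHk y yK); rewrite le_eqVlt; apply/orP; left; apply/eqP; ring.
    apply: le_trans (Hc z _ zH).
    rewrite exprD mulrA -[c * b1 * _]mulrA -[c * _ * b ^+ n]mulrA -![c * _ * _]mulrA.
    rewrite ler_wpM2l ?(ltW c0)//; apply: ler_pM.
    - by rewrite mulr_ge0 ?(ltW b10) ?(ltW (bn _)).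
    - by rewrite exprn_ge0.
    - by rewrite ler_wpM2r ?(ltW (bn _))// b1e.
    - rewrite lerXn2r ?nnegrE ?ler0n// ler_nat ltnS.
      by rewrite (leq_trans _ (leq_addl _ _))// (leq_trans _ (leq_addr _ _))// leq_pmulr.
  have Hqk : k.+2%:R ^+ j.+1 <= k.+1%:R ^+ j.+1 + q.+1%:R * k.+1%:R ^+ j :> R.
    rewrite -!natrX -natrM -natrD ler_nat (leq_trans (Hq k))// leq_add2l.
    by rewrite leq_mul2r leqnSn orbT.
  apply: (@le_trans _ _ (C * v x * b ^+ (D + n) *
    (k.+1%:R ^+ j.+1 + q.+1%:R * k.+1%:R ^+ j))).
    by rewrite ler_wpM2l// !mulr_ge0 ?(ltW C0) ?(ltW (bn _)) ?(ltW (v0 _ xK)).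
  rewrite mulrDr exprD; apply: lerD.
    by rewrite le_eqVlt; apply/orP; left; apply/eqP; ring.
  have -> : C * v x * (b ^+ D * b ^+ n) * (q.+1%:R * k.+1%:R ^+ j) =
    C * (v x * b ^+ D * q.+1%:R) * b ^+ n * k.+1%:R ^+ j by ring.
  rewrite !ler_wpM2r ?exprn_ge0 ?(ltW b0)//; apply: le_trans Cq.
  by rewrite ler_wpM2l ?(ltW C0)// !ler_wpM2r ?(ltW (bn _)).
have Dj0 : 0 < D%:R ^+ j.+1 :> R by rewrite exprn_gt0 ?ltr0n.
exists (C * e / D%:R ^+ j.+1) => [|x n xK]; first by rewrite divr_gt0 ?mulr_gt0.
(* The length is cut into [n %/ D] blocks and a remainder; [n.+1 <= (n %/ D).+1 * D] turns the
   number of blocks back into [n]. *)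
have := key (n %/ D)%N (n %% D)%N x xK; rewrite -divn_eq; apply: le_trans.
have -> : C * e / D%:R ^+ j.+1 * b ^+ n * n.+1%:R ^+ j.+1 =
  C * e * b ^+ n * (n.+1%:R ^+ j.+1 / D%:R ^+ j.+1) by ring.
apply: ler_pM.
- by rewrite !mulr_ge0 ?(ltW C0) ?(ltW e0) ?(ltW (bn _)).
- by rewrite divr_ge0 ?exprn_ge0.
- by rewrite ler_wpM2r ?(ltW (bn _))// ler_wpM2l ?(ltW C0)// ev.
- rewrite ler_pdivrMr// -exprMn lerXn2r ?nnegrE ?mulr_ge0 ?ler0n//.
  by rewrite -natrM ler_nat ltn_ceil.
Qed.

Lemma npaths_ge_chain H (b : R) l c : 0 < b -> rho_chain H b l c ->
  exists2 C, 0 < C & forall z n, z \in verts (c l) ->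
    C * b ^+ n * n.+1%:R ^+ l <= npaths R n z.
Proof.
move=> b0 [lt _ cb]; elim: l lt cb => [|l IHl] lt cb.
  have [C C0 HC] := npaths_ge_exp (c 0%N); exists C => // z n zc.
  by rewrite expr0 mulr1 -(cb 0%N)// HC.
have [i il|i il|C C0 HC] := IHl.
- by apply: lt; rewrite ltnW.
- by apply: cb; rewrite ltnW.
exact: npaths_ge_step (lt l _) (cb l.+1 _) b0 C0 HC.
Qed.

Lemma num_paths_ge H (b : R) l c : 0 < b -> rho_chain H b l c ->
  exists2 C, 0 < C & \forall n \near \oo, C * (b ^+ n * n%:R ^+ l) <= (num_paths H n)%:R.
Proof.
move=> b0 cH; have [C C0 HC] := npaths_ge_chain b0 cH.
have [_ /component_leP[x [z [xH zc xz]]] _] := cH.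
have [d Hd] := npaths_reachable R xz.
have D0 : 0 < b ^+ d * d.+1%:R ^+ l by rewrite mulr_gt0 ?exprn_gt0.
(* A path of length [d] from [H] to the top of the chain costs [d] steps; the constant absorbs them,
   as [n <= m.+1 * d.+1] for [m = n - d]. *)
exists (C / (b ^+ d * d.+1%:R ^+ l)); first exact: divr_gt0.
exists d => // n /= dn; rewrite num_pathsE (bigD1 x)//= -[leLHS]addr0.
apply: lerD; last first.
  by apply: sumr_ge0 => y _; exact: npaths_ge0.
rewrite -(subnKC dn); set m := (n - d)%N; apply: le_trans (Hd m).
apply: le_trans (HC z m zc); rewrite mulrAC ler_pdivrMr// exprD.
have -> : C * b ^+ m * m.+1%:R ^+ l * (b ^+ d * d.+1%:R ^+ l) =
  C * (b ^+ d * b ^+ m * (m.+1 * d.+1)%:R ^+ l) by rewrite natrM exprMn; ring.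
rewrite ler_wpM2l ?(ltW C0)// ler_wpM2l ?mulr_ge0 ?exprn_ge0 ?(ltW b0)//.
by rewrite lerXn2r ?nnegrE ?ler0n// ler_nat; nia.
Qed.

End LowerBound.

(** * Growth of the number of paths *)

Section Growth.
Variables (R : realType) (Q : finQuiver).
Implicit Types (H K L : component Q).

Lemma num_paths_le H (b g : R) m : 0 < b -> 0 < g -> g < 1 ->
  (forall L, rho R L < b -> rho R L < b * g) ->
  (forall L, (L <= H)%O -> rho R L <= b) ->
  ~ (exists c, rho_chain H b m c) ->
  exists2 C, 0 < C & forall n, (num_paths H n)%:R <= C * b ^+ n * geom_sum g m n.
Proof.
move=> b0 g0 g1 gap Hb nochain; have [C HC] := npaths_le b0 g0 g1 gap Hb nochain.
have bs n : 0 <= b ^+ n * geom_sum g m n.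
  by rewrite mulr_ge0 ?exprn_ge0 ?(ltW b0)// ltW// geom_sum_gt0.
exists (1 + #|verts H|%:R * Num.max 0 C) => [|n].
  by rewrite ltr_pwDl// mulr_ge0// le_max lexx.
rewrite num_pathsE -mulrA.
apply: (@le_trans _ _ (\sum_(x in verts H) Num.max 0 C * (b ^+ n * geom_sum g m n))).
  apply: ler_sum => x xH; apply: le_trans (HC x n xH) _.
  by rewrite -mulrA ler_wpM2r// le_max lexx orbT.
by rewrite sumr_const -[leLHS]mulr_natl mulrA ler_wpM2r// lerDr.
Qed.

Lemma num_paths_eventually0 H : (forall L, (L <= H)%O -> rho R L = 0) ->
  \forall n \near \oo, num_paths H n = 0%N.
Proof.
(* The upper bound applies with any positive [b] instead of [0], say [1/2], and
   then there is no chain at all: the number of paths tends to 0. *)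
move=> H0; have h0 : 0 < 2^-1 :> R by rewrite invr_gt0.
have [g [g0 g1 gap]] := rho_gap Q h0.
have [L LH||C C0 HC] := @num_paths_le H 2^-1 g 0 h0 g0 g1 gap.
- by rewrite H0// ltW.
- move=> [c [_ cH /(_ 0%N isT)]]; rewrite H0// => /esym/eqP.
  by rewrite gt_eqF.
(* From this [n] on, [C * 2^-1 ^+ n < 1], and a natural number below 1 is 0. *)
exists (Num.bound C) => // n /= Cn; apply/eqP; rewrite -leqn0 -ltnS -(ltr_nat R).
apply: le_lt_trans (HC n) _; apply: (@le_lt_trans _ _ (C * 2^-1 ^+ n)).
  apply: ler_piMr; first by rewrite mulr_ge0 ?exprn_ge0 ?(ltW C0) ?(ltW h0).
  by rewrite /= exprn_ile1 ?(ltW g0) ?(ltW g1).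
rewrite exprVn ltr_pdivrMr ?exprn_gt0// mul1r.
apply: lt_le_trans (archi_boundP (ltW C0)) _.
by rewrite -natrX ler_nat (leq_trans Cn)// ltnW// ltn_expl.
Qed.

Lemma complexity_class_eq (f g : nat -> R) (c1 c2 : R) : 0 < c1 -> 0 < c2 ->
  (\forall n \near \oo, c1 * g n <= f n <= c2 * g n) ->
  complexity_class f = complexity_class g.
Proof.
move=> c10 c20 fg; apply/seteqP; split => h [h0 [d1 [d2 [d10 d20 H]]]]; split => //.
- exists (d1 / c2), (d2 / c1); split; rewrite ?divr_gt0//.
  apply: filterS2 fg H => n /andP[gf fg] /andP[hf fh].
  rewrite mulrAC ler_pdivrMr// [g n * c2]mulrC (le_trans hf fg)/=.
  by rewrite mulrAC ler_pdivlMr// [g n * c1]mulrC (le_trans gf fh).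
- exists (c1 * d1), (c2 * d2); split; rewrite ?mulr_gt0//.
  apply: filterS2 fg H => n /andP[gf fg] /andP[hf fh].
  rewrite -!mulrA (le_trans _ gf) ?ler_wpM2l ?(ltW c10)//=.
  by rewrite (le_trans fg)// ler_wpM2l ?(ltW c20).
Qed.

End Growth.

Theorem proposition3p7 (R : realType) (Q : finQuiver) (H : component Q)
    (b : R) (l : nat)
    (hb : is_maximum [set rho R K | K in [set K : component Q | (K <= H)%O]] b)
    (hl : is_maximum [set k : nat | exists K, rho_chain H b k K] l) :
  cx R H = complexity_class (fun n : nat => b ^+ n * n%:R ^+ l).
Proof.
have [[K KH rK] bmax] := hb; have [[c cH] lmax] := hl.
have Hb L : (L <= H)%O -> rho R L <= b by move=> LH; apply: bmax; exists L.
have b_ge0 : 0 <= b by rewrite -rK rho_ge0.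
have [b0|/negPf bN0] := eqVneq b 0.
  (* The chain length [l] is irrelevant here: both sides vanish eventually. *)
  apply: (@complexity_class_eq R _ _ 1 1) => //.
  have : \forall n \near \oo, num_paths H n = 0%N.
    apply: (@num_paths_eventually0 R) => L LH; apply/eqP.
    by rewrite eq_le rho_ge0 -{1}b0 Hb.
  (* Taking [n > 0] excludes the value [0 ^+ 0 = 1]. *)
  apply: filterS2 (nbhs_infty_gt 0) => n n0 ->.
  by rewrite b0 expr0n gtn_eqF// mul0r mulr0 lexx.
have {b_ge0 bN0} b0 : 0 < b by rewrite lt_neqAle eq_sym bN0.
have [C1 C10 H1] := num_paths_ge b0 cH.
have [g [g0 g1 gap]] := rho_gap Q b0.
(* By maximality of [l] there is no chain of last index [l.+1], and [geom_sum g l.+1] is bounded by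
   a multiple of [n.+1%:R ^+ l]. *)
have [|C2 C20 H2] := @num_paths_le R Q H b g l.+1 b0 g0 g1 gap Hb.
  by move=> chain; have := lmax l.+1 chain; rewrite leEnat ltnn.
have [C3 C30 H3] := geom_sum_le g0 g1 l.
(* The factor [2 ^+ l] comes from [n.+1 <= 2 * n] for [n > 0]. *)
apply: (@complexity_class_eq R _ _ C1 (C2 * C3 * 2 ^+ l)) => //.
  by rewrite !mulr_gt0 ?exprn_gt0.
apply: filterS2 H1 (nbhs_infty_gt 0) => n -> /= n0.
apply: le_trans (H2 n) _.
have bn : 0 <= b ^+ n by rewrite exprn_ge0 ?ltW.
apply: (@le_trans _ _ (C2 * b ^+ n * (C3 * (2 * n%:R) ^+ l))).
  rewrite ler_wpM2l ?mulr_ge0 ?(ltW C20)//; apply: le_trans (H3 n) _.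
  rewrite ler_wpM2l ?(ltW C30)// lerXn2r ?nnegrE ?mulr_ge0 ?ler0n//.
  by rewrite -natrM ler_nat; lia.
by rewrite le_eqVlt exprMn; apply/orP; left; apply/eqP; ring.
Qed.
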